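(* For every integer $N \geq 5$, the set of typical coranks of $S = ([N]\times[N]) \setminus \{(i,i) : 1 \leq i \leq 5\}$ is exactly $\{2\}$. (In the paper's notation: $\mathrm{tc}(G(5,1)^{\mathsf c}) = \{2\}$.)
   Context: $[N] = \{1,\ldots,N\}$. For $S \subseteq [N]\times[N]$ (the specified entries), a partial filling is a point $A \in \mathbb{R}^S$. A real completion of $A$ is a matrix $M \in \mathbb{R}^{N\times N}$ with $M_{ij} = A_{ij}$ for all $(i,j)\in S$. An integer $r$ is a typical rank of $S$ if there is a nonempty Euclidean open subset of $\mathbb{R}^S$ such that for every $A$ in it, the minimum rank among all real completions of $A$ equals $r$. The typical coranks of $S$ are the numbers $N - r$ with $r$ a typical rank of $S$. For a finite set $U$ of unspecified entries, $\mathrm{tc}(U^{\mathsf c})$ denotes the set of typical coranks of $([N]\times[N])\setminus U$, for any $N$ with $U \subseteq [N]\times[N]$ (this does not depend on $N$). $G(5,1) = \{(i,i) : 1 \leq i \leq 5\}$. *)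

(* Defs.v *)
From HB Require Import structures.
From mathcomp Require Import all_boot all_order all_algebra.
From mathcomp Require Import all_classical all_reals all_analysis.
Import Order.TTheory GRing.Theory Num.Theory.
Import numFieldNormedType.Exports.

Set Implicit Arguments.
Unset Strict Implicit.
Unset Printing Implicit Defensive.

Local Open Scope classical_set_scope.
Local Open Scope ring_scope.

(* {ptws _ -> R} carries the product topology; its index type is finite here,
   so this is the Euclidean topology of R^S. *)
Definition partial_filling (R : realType) (N : nat)
    (S : {set 'I_N * 'I_N}) : topologicalType :=
  {ptws {p : 'I_N * 'I_N | p \in S} -> R}.

Definition completions (R : realType) (N : nat) (S : {set 'I_N * 'I_N})
    (A : partial_filling R S) : set 'M[R]_N :=
  [set M : 'M[R]_N | forall p : {p : 'I_N * 'I_N | p \in S},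
             M (val p).1 (val p).2 = A p].

Definition is_min_completion_rank (R : realType) (N : nat)
    (S : {set 'I_N * 'I_N}) (A : partial_filling R S) (r : nat) : Prop :=
  (exists2 M, completions A M & \rank M = r) /\
  (forall M, completions A M -> (r <= \rank M)%N).

Definition typical_rank (R : realType) (N : nat)
    (S : {set 'I_N * 'I_N}) (r : nat) : Prop :=
  exists O : set (partial_filling R S),
    [/\ open O, O !=set0 &
        forall A, O A -> is_min_completion_rank A r].

(* The subtraction never truncates: a typical rank is the rank of some
   N x N matrix. *)
Definition typical_coranks (R : realType) (N : nat)
    (S : {set 'I_N * 'I_N}) : set nat :=
  [set (N - r)%N | r in [set r | typical_rank R S r]].

(* The entries (1,1), ..., (g,g); the indices in 'I_N start at 0. *)
Definition diag_entries (N g : nat) : {set 'I_N * 'I_N} :=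
  [set p : 'I_N * 'I_N | (p.1 == p.2) && (p.1 < g)%N]%SET.

(* Main.v *)
(** A Schur complement with respect to the lower right block, generically
    invertible and fully specified, reduces to 5 x 5 matrices with free diagonal.
    For generic off-diagonal entries such a matrix has a completion of rank 3:
    a vector on the rows 0, 1, 2 orthogonal to the columns 3 and 4 becomes a left
    kernel vector for a suitable choice of the first three diagonal entries, and
    then a vector on the rows 1 to 4 orthogonal to the columns 0, 1, 2 becomes
    one for a suitable choice of the last two. Rank 2 is generically impossible,
    because two 3 x 3 minors prescribe different values for the entry (2,2).
    Genericity is the nonvanishing of a polynomial, hence an open dense
    condition, so that N - 2 is the only typical rank. *)
Require Import Defs.
From mathcomp Require Import all_boot all_order all_algebra.
From mathcomp Require Import all_classical all_reals all_analysis.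
From mathcomp Require Import ring.
Import Order.TTheory GRing.Theory Num.Theory.
Import numFieldNormedType.Exports.

Set Implicit Arguments.
Unset Strict Implicit.
Unset Printing Implicit Defensive.

Local Open Scope classical_set_scope.

(** * Five by five matrices with free diagonal *)

Section FiveByFive.
Local Open Scope ring_scope.
Variable F : fieldType.
Implicit Types K : 'M[F]_5.

Local Notation ent K i j := (K (@inord 4 i) (@inord 4 j)).

Lemma big_ord5 (f : 'I_5 -> F) :
  \sum_i f i =
  f (inord 0) + f (inord 1) + f (inord 2) + f (inord 3) + f (inord 4).
Proof.
rewrite !big_ord_recr big_ord0 /=.
by rewrite add0r /=; do !congr (_ + _); congr f;
  apply: val_inj; rewrite /= inordK.
Qed.

Lemma ord5_ind (P : 'I_5 -> Prop) :
  P (inord 0) -> P (inord 1) -> P (inord 2) -> P (inord 3) -> P (inord 4) ->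
  forall i, P i.
Proof.
move=> P0 P1 P2 P3 P4 i; rewrite -(inord_val i).
by case: i => [[|[|[|[|[|?]]]]]].
Qed.

Lemma rank_mxsub m n m' n' (f : 'I_m' -> 'I_m) (g : 'I_n' -> 'I_n)
    (A : 'M[F]_(m, n)) :
  (\rank (mxsub f g A) <= \rank A)%N.
Proof.
have -> : mxsub f g A = rowsub f 1%:M *m (A *m colsub g 1%:M).
  by rewrite -rowsubE mulmx_colsub mulmx1; apply/matrixP=> i j; rewrite !mxE.
exact: leq_trans (mxrankM_maxr _ _) (mxrankM_maxl _ _).
Qed.

Lemma det2 (A : 'M[F]_2) : \det A = A 0 0 * A 1 1 - A 0 1 * A 1 0.
Proof.
rewrite (expand_det_row _ 0) !big_ord_recl big_ord0 /cofactor !det_mx11 !mxE /=.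
rewrite expr0 expr1 !mul1r mulN1r mulrN addr0.
by do ![congr (_ + _)| congr (_ * _) | congr (- _) | congr (A _ _)]; apply: val_inj.
Qed.

Lemma det3 (f : nat -> nat -> F) :
  \det (\matrix_(i < 3, j < 3) f i j) =
  f 0%N 0%N * (f 1%N 1%N * f 2%N 2%N - f 1%N 2%N * f 2%N 1%N)
   - f 0%N 1%N * (f 1%N 0%N * f 2%N 2%N - f 1%N 2%N * f 2%N 0%N)
   + f 0%N 2%N * (f 1%N 0%N * f 2%N 1%N - f 1%N 1%N * f 2%N 0%N).
Proof.
rewrite (expand_det_row _ 0) !big_ord_recl big_ord0 /cofactor !det2 !mxE /=.
rewrite /bump /=; ring.
Qed.

(* The vector [(cross0 K, cross1 K, cross2 K)] is orthogonal to the columns 3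
   and 4 of the rows 0, 1, 2, which contain no diagonal entry. *)
Definition cross0 K := ent K 1 3 * ent K 2 4 - ent K 1 4 * ent K 2 3.
Definition cross1 K := ent K 2 3 * ent K 0 4 - ent K 2 4 * ent K 0 3.
Definition cross2 K := ent K 0 3 * ent K 1 4 - ent K 0 4 * ent K 1 3.

(* [volume K r] is the 3 x 3 determinant in the columns 0, 1, 2 of the rows
   [cross1 K * row 1], [cross2 K * row 2] and [row r], where the diagonal entries
   of the rows 1 and 2 are those making [cross K] a left kernel vector; the
   [volume_coef]s are its cofactors along the last row. *)
Definition volume_coef0 K :=
  (cross0 K * ent K 0 1 + cross2 K * ent K 2 1) *
  (cross0 K * ent K 0 2 + cross1 K * ent K 1 2) -
  cross1 K * ent K 1 2 * (cross2 K * ent K 2 1).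
Definition volume_coef1 K :=
  cross1 K * ent K 1 2 * (cross2 K * ent K 2 0) +
  cross1 K * ent K 1 0 * (cross0 K * ent K 0 2 + cross1 K * ent K 1 2).
Definition volume_coef2 K :=
  cross1 K * ent K 1 0 * (cross2 K * ent K 2 1) +
  (cross0 K * ent K 0 1 + cross2 K * ent K 2 1) * (cross2 K * ent K 2 0).
Definition volume K r :=
  ent K r 0 * volume_coef0 K + ent K r 1 * volume_coef1 K + ent K r 2 * volume_coef2 K.

(* In a completion of rank at most 2, the vanishing of the minor with rows
   0, 1, 2 and columns 2, 3, 4 and of the transposed minor are two affine
   equations for the entry (2,2); this is their resultant. *)
Definition resultant22 K :=
  cross2 K * (cross0 K^T * ent K 2 0 + cross1 K^T * ent K 2 1) -
  cross2 K^T * (cross0 K * ent K 0 2 + cross1 K * ent K 1 2).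

Definition generic5 K :=
  cross0 K * cross1 K * cross2 K * volume K 3 * volume K 4 * resultant22 K.

Lemma inord5_eq (i j : nat) : (i < 5)%N -> (j < 5)%N ->
  (@inord 4 i == @inord 4 j) = (i == j).
Proof. by move=> li lj; rewrite -val_eqE /= !inordK. Qed.

(** Only off-diagonal entries occur in the formula, so this is a condition on the specified
    entries. *)
Lemma generic5_congr K (K' : 'M[F]_5) :
  (forall i j, i != j -> K i j = K' i j) -> generic5 K = generic5 K'.
Proof.
move=> KK'; rewrite /generic5 /resultant22 /volume.
rewrite /volume_coef0 /volume_coef1 /volume_coef2 /cross0 /cross1 /cross2.
by rewrite !mxE !KK' // ?inord5_eq.
Qed.

Lemma generic5_rank_ge3 K : generic5 K != 0 -> (3 <= \rank K)%N.
Proof.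
rewrite /generic5 !mulf_eq0 !negb_or => /andP[_ res0].
rewrite ltnNge; apply: contraNN res0 => rK2.
have minor0 (a b : nat -> nat) :
    \det (\matrix_(i < 3, j < 3) ent K (a i) (b j)) = 0.
  apply/eqP; apply: contraTT rK2 => detN0; rewrite -ltnNge.
  apply: leq_trans (rank_mxsub (fun i : 'I_3 => inord (a i))
                               (fun j : 'I_3 => inord (b j)) K).
  rewrite mxrank_unit // unitmxE unitfE; apply: contra_neq detN0 => <-.
  by congr (\det _); apply/matrixP=> i j; rewrite !mxE.
(* Rows 2, 3, 4 with columns 0, 1, 2, then the transposed choice: the only diagonal entry in either
   minor is (2,2). *)
have := minor0 (addn 2) id; rewrite (det3 (fun i j => ent K (2 + i) j)) /= => E2.
have := minor0 id (addn 2); rewrite (det3 (fun i j => ent K i (2 + j))) /= => E1.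
apply/eqP.
have := congr2 (fun x y => cross2 K * y - cross2 K^T * x) E1 E2.
rewrite /= !mulr0 subrr => <-.
rewrite /resultant22 /cross0 /cross1 /cross2 !mxE; ring.
Qed.

Lemma generic5_completion K : generic5 K != 0 ->
  exists2 K' : 'M[F]_5, (forall i j, i != j -> K' i j = K i j) & (\rank K' <= 3)%N.
Proof.
rewrite /generic5 !mulf_eq0 !negb_or.
move=> /andP[/andP[/andP[/andP[/andP[l0 l1 l2 v3 v4 _]]]]].
(* [r2] and [r3] are the completed rows 1 and 2 in columns 0, 1, 2, scaled by [cross1 K] and
   [cross2 K] to clear denominators; [tri] is the 3 x 3 determinant. *)
pose r2 := [:: cross1 K * ent K 1 0; - (cross0 K * ent K 0 1 + cross2 K * ent K 2 1);
               cross1 K * ent K 1 2].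
pose r3 := [:: cross2 K * ent K 2 0; cross2 K * ent K 2 1;
               - (cross0 K * ent K 0 2 + cross1 K * ent K 1 2)].
pose tri (u v w : nat -> F) := u 0%N * (v 1%N * w 2%N - v 2%N * w 1%N)
   - u 1%N * (v 0%N * w 2%N - v 2%N * w 0%N) + u 2%N * (v 0%N * w 1%N - v 1%N * w 0%N).
pose m1 := cross1 K * tri (nth 0 r3) (fun j => ent K 3 j) (fun j => ent K 4 j).
pose m2 := - (cross2 K * tri (nth 0 r2) (fun j => ent K 3 j) (fun j => ent K 4 j)).
pose x := [:: - (cross1 K * ent K 1 0 + cross2 K * ent K 2 0) / cross0 K;
              - (cross0 K * ent K 0 1 + cross2 K * ent K 2 1) / cross1 K;
              - (cross0 K * ent K 0 2 + cross1 K * ent K 1 2) / cross2 K;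
              - (m1 * ent K 1 3 + m2 * ent K 2 3 - volume K 3 * ent K 4 3) / volume K 4;
              (m1 * ent K 1 4 + m2 * ent K 2 4 + volume K 4 * ent K 3 4) / volume K 3].
(* The second row is the relation between the rows 1 to 4 of the columns 0, 1, 2,
   given by Cramer's rule; the last two diagonal entries extend it to the
   columns 3 and 4. *)
pose L := \matrix_(i < 2, j < 5)
  (nth [::] [:: [:: cross0 K; cross1 K; cross2 K; 0; 0];
                [:: 0; m1; m2; volume K 4; - volume K 3]] i)`_j.
pose K' := \matrix_(i < 5, j < 5) if i == j then x`_i else K i j.
exists K' => [i j ij|]; first by rewrite mxE (negPf ij).
(* Column 0 of [L] is nonzero only in the first row, column 4 only in the second. *)
have rankL : \rank L = 2%N.
  apply/eqP/inj_row_free => v vL0; apply/rowP=> i; rewrite mxE.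
  move/rowP: vL0 => vL0; have := vL0 (inord 0); have := vL0 (inord 4).
  rewrite !mxE !big_ord_recl !big_ord0 !mxE !inordK //= => E4 E0.
  move: E4 E0; rewrite !mulr0 !addr0 !add0r mulrN.
  move=> /eqP; rewrite oppr_eq0 mulf_eq0 (negPf v3) orbF => /eqP v1.
  move=> /eqP; rewrite mulf_eq0 (negPf l0) orbF => /eqP v0.
  by case: i => [[|[|//]] ?]; [rewrite -[RHS]v0 | rewrite -[RHS]v1];
    congr (v _ _); apply: val_inj.
suff LK : L *m K' = 0.
  by have := mulmx0_rank_max LK; rewrite rankL.
apply/matrixP=> i j; rewrite !mxE big_ord5 !mxE !inordK //=.
case: i => [[|[|//]] ?] /=; elim/ord5_ind: j; rewrite !inord5_eq //=.
(* First row of [L]: columns 0, 1, 2 vanish by the choice of [x], columns 3 and 4 by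
   orthogonality. *)
1-3: by field.
1,2: by rewrite !mul0r !addr0 /cross0 /cross1 /cross2; ring.
1-3: rewrite /m1 /m2 /tri /r2 /r3 /volume /=.
1-3: by rewrite /volume_coef0 /volume_coef1 /volume_coef2; field.
all: by field.
Qed.

(** Zero-one entries at which [generic5] equals 1, so that genericity is not vacuous over any
    field. *)
Definition witness5 : 'M[F]_5 :=
  \matrix_(i < 5, j < 5)
    (nth 0%N (nth [::] [:: [:: 0; 0; 0; 1; 0]; [:: 1; 0; 0; 0; 1];
                           [:: 0; 1; 0; 1; 1]; [:: 0; 0; 1; 0; 0];
                           [:: 1; 0; 1; 0; 0]]%N i) j)%:R.

Lemma generic5_witness : generic5 witness5 = 1.
Proof.
rewrite /generic5 /resultant22 /volume /volume_coef0 /volume_coef1 /volume_coef2.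
rewrite /cross0 /cross1 /cross2 !mxE !inordK //=; ring.
Qed.

End FiveByFive.

(** * Rank and Schur complement *)

Section Schur.
Local Open Scope ring_scope.
Variables (F : fieldType) (m n : nat).
Implicit Types M : 'M[F]_(m + n).

(** The usual Schur complement times the determinant of the lower right block: the adjugate keeps
    the entries polynomial. *)
Definition schur M : 'M[F]_m :=
  \det (drsubmx M) *: ulsubmx M - ursubmx M *m \adj (drsubmx M) *m dlsubmx M.

Lemma rank_schur M : \det (drsubmx M) != 0 -> \rank M = (\rank (schur M) + n)%N.
Proof.
set T := drsubmx M => d0.
have Tu : T \in unitmx by rewrite unitmxE unitfE.
(* [V] clears the lower left block and forms the Schur complement; [U] then clears the upper right
   block. *)
pose U := block_mx 1%:M (- (ursubmx M *m invmx T)) 0 1%:M : 'M[F]_(m + n).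
pose V := block_mx (\det T)%:M 0 (- (\adj T *m dlsubmx M)) 1%:M : 'M[F]_(m + n).
have Uu : U \in unitmx by rewrite unitmxE det_ublock !det1 mulr1 unitr1.
have Vu : V \in unitmx.
  by rewrite unitmxE det_lblock det1 mulr1 det_scalar unitfE expf_neq0.
have E : U *m (M *m V) = block_mx (schur M) 0 0 T.
  rewrite -{1}[M]submxK /U /V !mulmx_block -/T.
  rewrite !mul1mx !mul0mx !mulmx1 !mulmx0 !add0r !mulmxN !mulmxA mul_mx_adj.
  rewrite !mul_mx_scalar !mul_scalar_mx subrr !mulmx0 addr0 mulNmx mulmxKV //.
  by rewrite subrr.
rewrite -(mxrankMfree M (B := V)) ?row_free_unit //.
rewrite -(eqmxMfull (M *m V) (A := U)) ?row_full_unit //.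
by rewrite E rank_diag_block_mx (mxrank_unit Tu).
Qed.

End Schur.

(** * Polynomial functions on the space of partial fillings *)

Section Regular.
Local Open Scope ring_scope.
Variables (R : realType) (N : nat) (S : {set 'I_N * 'I_N}).
Local Notation X := (partial_filling R S).

Definition on_line (A B : X) (t : R) : X := fun s => A s + t * (B s - A s).

(** Stands in for polynomial functions: continuity makes the nonvanishing locus open, polynomiality
    along lines makes it dense once nonempty. *)
Definition regular (f : X -> R) :=
  continuous f /\
  forall A B, exists p : {poly R}, forall t, f (on_line A B t) = p.[t].

Lemma regular_cst c : regular (fun=> c).
Proof.
split=> [|A B]; first exact: cst_continuous.
by exists c%:P => t; rewrite hornerC.
Qed.

Lemma regular_coord s : regular (fun A => A s).
Proof.
split=> [|A B]; first exact: (@proj_continuous _ (fun=> R : topologicalType) s).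
by exists ((A s)%:P + 'X * (B s - A s)%:P) => t; rewrite !hornerE.
Qed.

Lemma regularD f g : regular f -> regular g -> regular (fun A => f A + g A).
Proof.
move=> [cf pf] [cg pg]; split=> [A|A B]; first exact: cvgD (cf A) (cg A).
have [p fp] := pf A B; have [q gq] := pg A B.
by exists (p + q) => t; rewrite hornerD fp gq.
Qed.

Lemma regularM f g : regular f -> regular g -> regular (fun A => f A * g A).
Proof.
move=> [cf pf] [cg pg]; split=> [A|A B]; first exact: cvgM (cf A) (cg A).
have [p fp] := pf A B; have [q gq] := pg A B.
by exists (p * q) => t; rewrite hornerM fp gq.
Qed.

Lemma regularN f : regular f -> regular (fun A => - f A).
Proof.
move=> rf; have -> : (fun A => - f A) = (fun A => (-1) * f A).
  by apply/funext => A; rewrite mulN1r.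
exact: regularM (regular_cst _) rf.
Qed.

Lemma regular_sum (I : Type) (r : seq I) (P : pred I) (f : I -> X -> R) :
  (forall i, regular (f i)) -> regular (fun A => \sum_(i <- r | P i) f i A).
Proof.
move=> rf; elim: r => [|i r IHr].
  under eq_fun do rewrite big_nil; exact: regular_cst.
under eq_fun do rewrite big_cons; case: (P i) => //; exact: regularD.
Qed.

Lemma regular_prod (I : Type) (r : seq I) (P : pred I) (f : I -> X -> R) :
  (forall i, regular (f i)) -> regular (fun A => \prod_(i <- r | P i) f i A).
Proof.
move=> rf; elim: r => [|i r IHr].
  under eq_fun do rewrite big_nil; exact: regular_cst.
under eq_fun do rewrite big_cons; case: (P i) => //; exact: regularM.
Qed.

Definition regular_mx m n (F : X -> 'M[R]_(m, n)) :=
  forall i j, regular (fun A => F A i j).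

Lemma regular_det m (F : X -> 'M[R]_m) :
  regular_mx F -> regular (fun A => \det (F A)).
Proof.
move=> rF; apply: regular_sum => s; apply: regularM; first exact: regular_cst.
by apply: regular_prod.
Qed.

Lemma regular_adj m (F : X -> 'M[R]_m) :
  regular_mx F -> regular_mx (fun A => \adj (F A)).
Proof.
move=> rF i j; under eq_fun do rewrite mxE.
apply: regularM; first exact: regular_cst.
by apply: regular_det => k l; under eq_fun do rewrite !mxE.
Qed.

Lemma regular_mulmx m n p (F : X -> 'M[R]_(m, n)) (G : X -> 'M[R]_(n, p)) :
  regular_mx F -> regular_mx G -> regular_mx (fun A => F A *m G A).
Proof.
move=> rF rG i j; under eq_fun do rewrite mxE.
by apply: regular_sum => k; apply: regularM.
Qed.

Lemma regular_schur m n (F : X -> 'M[R]_(m + n)) :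
  regular_mx F -> regular_mx (fun A => schur (F A)).
Proof.
move=> rF i j; rewrite /schur.
have rdr : regular_mx (fun A => drsubmx (F A)).
  by move=> k l; under eq_fun do rewrite !mxE.
under eq_fun do rewrite !mxE.
apply: regularD; first by apply: regularM => //; apply: regular_det.
apply: regularN; apply: regular_sum => k; apply: regularM.
  apply: regular_mulmx; last exact: regular_adj.
  by move=> u v; under eq_fun do rewrite !mxE.
by under eq_fun do rewrite !mxE.
Qed.

Lemma regular_trmx m n (F : X -> 'M[R]_(m, n)) :
  regular_mx F -> regular_mx (fun A => (F A)^T).
Proof. by move=> rF i j; under eq_fun do rewrite mxE. Qed.

Ltac regularity := lazymatch goal with
  | |- regular (fun A => @?f A + @?g A) => apply: (@regularD f g); regularity
  | |- regular (fun A => @?f A * @?g A) => apply: (@regularM f g); regularity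
  | |- regular (fun A => - @?f A) => apply: (@regularN f); regularity
  | _ => auto
  end.

Lemma regular_cross (F : X -> 'M[R]_5) : regular_mx F ->
  [/\ regular (fun A => cross0 (F A)), regular (fun A => cross1 (F A)) &
      regular (fun A => cross2 (F A))].
Proof.
move=> rF; rewrite /cross0 /cross1 /cross2; split; regularity.
Qed.

Lemma regular_volume (F : X -> 'M[R]_5) r :
  regular_mx F -> regular (fun A => volume (F A) r).
Proof.
move=> rF; have [r0 r1 r2] := regular_cross rF.
rewrite /volume /volume_coef0 /volume_coef1 /volume_coef2.
regularity.
Qed.

Lemma regular_generic5 (F : X -> 'M[R]_5) :
  regular_mx F -> regular (fun A => generic5 (F A)).
Proof.
move=> rF; have [r0 r1 r2] := regular_cross rF.
have [t0 t1 t2] := regular_cross (regular_trmx rF).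
have rv k := @regular_volume F k rF.
rewrite /generic5 /resultant22.
regularity.
Qed.

Lemma open_regular_neq0 f : regular f -> open [set A | f A != 0].
Proof.
move=> [cf _]; rewrite -[X in open X]/(f @^-1` [set x | x != 0]).
exact: open_comp.
Qed.

Lemma cvg_on_line A B : on_line A B t @[t --> 0] --> A.
Proof.
apply/cvg_sup; first exact: fmap_filter.
move=> s U [_ [[W oW <-] /= WA]] WU.
have cvg_s : A s + t * (B s - A s) @[t --> 0] --> A s.
  rewrite -[X in _ --> X]addr0 -[X in _ --> _ + X](mul0r (B s - A s)).
  by apply: cvgD; [exact: cvg_cst | apply: cvgM; [exact: cvg_id | exact: cvg_cst]].
have nW : nbhs (A s) W by apply: open_nbhs_nbhs.
apply: (@filterS _ (nbhs (0 : R)) _ _ _ _ (cvg_s _ nW)) => t /= Wt; exact: WU.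
Qed.

Lemma poly_neq0_near (p : {poly R}) (P : R -> Prop) :
  p != 0 -> (\forall t \near 0, P t) -> exists2 t, P t & p.[t] != 0.
Proof.
move=> p0 /nbhs_ballP [e /= e0 eP].
(* These are [size p] distinct points, more than [p] has roots; the shift by 2 keeps them strictly
   within distance [e] of 0. *)
pose ts := [seq e / (k.+2)%:R | k <- iota 0 (size p)].
have uts : uniq ts.
  rewrite map_inj_uniq ?iota_uniq // => i j /(mulfI (lt0r_neq0 e0)) /invr_inj.
  by move=> /eqP; rewrite eqr_nat => /eqP [].
case: (boolP (all (root p) ts)) => [rts|].
  by have := max_poly_roots p0 rts uts; rewrite size_map size_iota ltnn.
move=> /allPn [t /mapP[k _ ->]] pt; exists (e / (k.+2)%:R) => //.
apply: eP; rewrite /ball /= sub0r normrN gtr0_norm ?divr_gt0 // ltr_pdivrMr //.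
by rewrite ltr_pMr // ltr1n.
Qed.

(** On the line from a point of [O] to [B] the function is a polynomial, nonzero at 1, hence nonzero
    at some small parameter where the line is still in [O]. *)
Lemma regular_neq0_dense f (B : X) (O : set X) : regular f -> f B != 0 ->
  open O -> O !=set0 -> exists2 A, O A & f A != 0.
Proof.
move=> [_ pf] fB oO [A OA]; have [p fp] := pf A B.
have p0 : p != 0.
  apply: contra_neq fB => p0; have := fp 1; rewrite p0 horner0 => <-.
  by congr f; apply/funext => s; rewrite /on_line; ring.
have nO : nbhs A O by apply: open_nbhs_nbhs.
have [t Ot pt] := poly_neq0_near p0 (cvg_on_line B nO).
by exists (on_line A B t); rewrite ?fp.
Qed.

Definition fill (A : X) : 'M[R]_N :=
  \matrix_(i, j) oapp (A : _ -> R) 0 (insub (i, j)).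

Lemma regular_fill : regular_mx fill.
Proof.
move=> i j; under eq_fun do rewrite mxE.
by case: insub => [s|] /=; [exact: regular_coord | exact: regular_cst].
Qed.

Definition restrict (M : 'M[R]_N) : X := fun s => M (val s).1 (val s).2.

Definition agree (M M' : 'M[R]_N) :=
  forall i j, (i, j) \in S -> M i j = M' i j.

Lemma completionsE A M : completions A M <-> agree M (fill A).
Proof.
split=> [AM i j ijS|AM [[i j] ijS]].
  by rewrite mxE insubT /= -(AM (exist (fun p => p \in S) (i, j) ijS)).
by rewrite [LHS](AM i j ijS) mxE insubT /=; congr (A _); apply: val_inj.
Qed.

Lemma agree_fill_restrict M : agree M (fill (restrict M)).
Proof. exact/completionsE. Qed.

End Regular.

(** * Generic partial fillings of arbitrary size *)

Section Generic.
Local Open Scope ring_scope.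
Variables (R : realType) (n : nat).
Local Notation S := (~: diag_entries (5 + n) 5)%SET.
Implicit Types M : 'M[R]_(5 + n).

Definition generic M := \det (drsubmx M) * generic5 (schur M).

Lemma agree_blocks M (M' : 'M[R]_(5 + n)) : agree S M M' ->
  [/\ forall i j, i != j -> ulsubmx M i j = ulsubmx M' i j,
      ursubmx M = ursubmx M', dlsubmx M = dlsubmx M' & drsubmx M = drsubmx M'].
Proof.
move=> MM'; split=> [i j ij|||]; [|apply/matrixP=> i j..]; rewrite !mxE;
  apply: MM'; rewrite !inE ?eq_shift //= negb_and ?ij //.
by rewrite -leqNgt leq_addr orbT.
Qed.

(** The unspecified entries reach only the diagonal of the Schur complement, which [generic5] does
    not read; so the zeros that [fill] puts there are harmless. *)
Lemma generic_congr M (M' : 'M[R]_(5 + n)) :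
  agree S M M' -> generic M = generic M'.
Proof.
move=> /agree_blocks[ul ur dl dr]; rewrite /generic dr; congr (_ * _).
by apply: generic5_congr => i j ij; rewrite /schur ur dl dr mxE [RHS]mxE;
  congr (_ + _); rewrite mxE [RHS]mxE ul.
Qed.

Lemma generic_rank_ge M : generic M != 0 -> (3 + n <= \rank M)%N.
Proof.
rewrite mulf_eq0 negb_or => /andP[d0 g0].
by rewrite rank_schur // leq_add2r generic5_rank_ge3.
Qed.

Lemma generic_completion M : generic M != 0 ->
  exists2 M' : 'M[R]_(5 + n), agree S M' M & (\rank M' <= 3 + n)%N.
Proof.
rewrite mulf_eq0 negb_or => /andP[d0 /generic5_completion[K KM rK]].
pose d := \det (drsubmx M).
pose Q := ursubmx M *m \adj (drsubmx M) *m dlsubmx M.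
(* The upper left block is solved for so that the Schur complement becomes [K]. *)
pose M' := block_mx (d^-1 *: (K + Q)) (ursubmx M) (dlsubmx M) (drsubmx M).
have sM' : schur M' = K.
  rewrite /schur /M' block_mxKul block_mxKur block_mxKdl block_mxKdr -/d -/Q.
  by rewrite scalerA mulfV // scale1r addrK.
exists M'; last by rewrite rank_schur ?sM' ?leq_add2r // /M' block_mxKdr.
move=> i j; rewrite -[M in RHS]submxK.
case: (split_ordP i) => i' ->; case: (split_ordP j) => j' -> ijS;
  rewrite ?block_mxEul ?block_mxEur ?block_mxEdl ?block_mxEdr //.
have ij : i' != j'.
  by move: ijS; rewrite !inE /= eq_shift negb_and (ltn_ord i') orbF.
by rewrite mxE mxE KM // /schur !mxE subrK mulKf.
Qed.

Lemma generic_witness : generic (block_mx (witness5 R) 0 0 1%:M) = 1.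
Proof.
rewrite /generic /schur block_mxKul block_mxKur block_mxKdl block_mxKdr.
by rewrite det1 !mul0mx subr0 scale1r generic5_witness mulr1.
Qed.

Lemma generic_min_completion_rank (A : partial_filling R S) :
  generic (fill A) != 0 -> is_min_completion_rank A (3 + n).
Proof.
move=> gA; have ge M : completions A M -> (3 + n <= \rank M)%N.
  by move=> /completionsE/generic_congr gM; rewrite generic_rank_ge // gM.
split=> //; have [M AM rM] := generic_completion gA.
have cM : completions A M by apply/completionsE.
by exists M => //; apply/eqP; rewrite eqn_leq rM ge.
Qed.

End Generic.

(** * The typical coranks *)

Lemma min_completion_rank_unique (R : realType) (N : nat) (S : {set 'I_N * 'I_N})
    (A : partial_filling R S) (r r' : nat) :
  is_min_completion_rank A r -> is_min_completion_rank A r' -> r = r'.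
Proof.
move=> [[M AM <-] ler] [[M' AM' <-] ler'].
by apply/eqP; rewrite eqn_leq ler // ler'.
Qed.

Theorem proposition3p12 (R : realType) (N : nat) (hN : (5 <= N)%N) :
  typical_coranks R (~: diag_entries N 5)%SET = [set 2%N].
Proof.
rewrite -(subnKC hN); set n := (N - 5)%N.
pose g (A : partial_filling R (~: diag_entries (5 + n) 5)%SET) := generic (fill A).
have rg : regular g.
  apply: regularM; last exact/regular_generic5/regular_schur/regular_fill.
  by apply: regular_det => i j; under eq_fun do rewrite 2!mxE; exact: regular_fill.
pose B := @restrict R _ (~: diag_entries (5 + n) 5)%SET
                    (block_mx (witness5 R) 0%R 0%R 1%:M%R).
have gB : (g B != 0)%R.
  by rewrite /g -(generic_congr (agree_fill_restrict _)) generic_witness oner_neq0.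
apply/seteqP; split=> [_ [r [U [oU U0 Ur]] <-]|_ ->] /=.
  (* A nonempty open set of constant minimal rank meets the generic locus, where that rank is 3 +
     n. *)
  have [A UA gA] := regular_neq0_dense rg gB oU U0.
  rewrite (min_completion_rank_unique (Ur _ UA) (generic_min_completion_rank gA)).
  by rewrite subnDr.
(* Conversely, the generic locus itself is open, and the witness lies in it. *)
exists (3 + n)%N; last by rewrite subnDr.
exists [set A | (g A != 0)%R]; split; first exact: open_regular_neq0.
- by exists B.
- by move=> A; exact: generic_min_completion_rank.
Qed.
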